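(* Let $(M_n)_{n\in\mathbb N}$ be a local martingale with respect to a filtration $(\mathcal G_n)_{n\in\mathbb N}$, with $M_0=0$ and increments $\Delta M_n:=M_n-M_{n-1}=s_{n-1}\zeta_n$ for all $n\ge1$, where $(s_n)_{n\in\mathbb N}$ is a $(\mathcal G_n)$-adapted sequence of real random variables and $(\zeta_n)_{n\ge1}$ is a sequence of $(\mathcal G_n)$-martingale increments such that, for $\alpha=1$ or $\alpha=2$ and some $\mu>0$, $\gamma>1$, $$\mathbb E\big[\exp(\mu|\zeta_k|^\alpha)\mid\mathcal G_{k-1}\big]\le\gamma\qquad\text{for any }k\ge1.$$ Let $V_n:=\sum_{k=1}^n s_{k-1}^2$. (i) If $\alpha=2$, then for any $\lambda\in[0,\frac{\mu}{2(1+\gamma)})$, any $a>0$ and any finite stopping time $T$, $$\mathbb E\Big[\exp\Big(\lambda\frac{aM_T^2}{(a+V_T)^2}\Big)\Big]\le1+c_\lambda,$$ where $c_\lambda:=\exp\Big(\frac{\lambda\Gamma_\lambda}{2(1-2\lambda\Gamma_\lambda)}\Big)\big(\exp(\lambda\Gamma_\lambda)-1\big)$ and $\Gamma_\lambda:=\frac{1+2\gamma}{2(\mu-\lambda)}$. (ii) If $\alpha=1$, then for any $\lambda\in(-\mu,\mu)$, any $a>0$ and any finite stopping time $T$, $$\mathbb E\Big[\cosh\Big(\lambda\frac{\sqrt a\,M_T}{a+V_T}\Big)\Big]\le1+c'_\lambda,$$ where $c'_\lambda=\frac{(\gamma-1)\lambda^2}{\mu^2}\exp\Big(\frac{(\g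amma-1)\lambda^2}{\mu^2}\Big)\cosh\Big(2\log2+\frac{2(\gamma-1)\lambda^2}{\mu^2}\Big)$.
   Context: Stopping times are with respect to $(\mathcal G_n)$ and take values in $\mathbb N=\{0,1,2,\dots\}$. A sequence $(\zeta_n)_{n\ge1}$ of $(\mathcal G_n)$-martingale increments is $(\mathcal G_n)$-adapted with $\mathbb E(|\zeta_n|\mid\mathcal G_{n-1})<\infty$ and $\mathbb E(\zeta_n\mid\mathcal G_{n-1})=0$. $\cosh(x)=(e^x+e^{-x})/2$, and $V_0=0$. *)

(* Defs.v *)
From HB Require Import structures.
From mathcomp Require Import all_boot all_order all_algebra.
From mathcomp Require Import all_classical all_reals all_analysis.
From mathcomp Require Import measurable_realfun.
Set Implicit Arguments.
Unset Strict Implicit.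
Unset Printing Implicit Defensive.
Import Order.TTheory GRing.Theory Num.Theory.
Import numFieldNormedType.Exports.
Local Open Scope classical_set_scope.
Local Open Scope ring_scope.

Definition filtration d (Omega : measurableType d) (G : nat -> set (set Omega)) :=
  [/\ forall n, sigma_algebra setT (G n),
      forall n, G n `<=` measurable &
      forall m n, (m <= n)%N -> G m `<=` G n].

(* [g_sigma_algebraType G] is [Omega] with the sigma-algebra generated by [G],
   which is [G] itself when [G] is a sigma-algebra. *)
Definition sub_measurable d (Omega : measurableType d) d' (S : measurableType d')
    (G : set (set Omega)) (X : Omega -> S) :=
  measurable_fun [set: g_sigma_algebraType G] (X : g_sigma_algebraType G -> S).

Definition adapted d (Omega : measurableType d) d' (S : measurableType d')
    (G : nat -> set (set Omega)) (X : nat -> Omega -> S) :=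
  forall n, sub_measurable (G n) (X n).

Definition stopping_time d (Omega : measurableType d)
    (G : nat -> set (set Omega)) (T : Omega -> nat) :=
  forall n, G n [set w | (T w <= n)%N].

Section conditional_expectation.
Context d (Omega : measurableType d) (R : realType) (P : probability Omega R).
Local Open Scope ereal_scope.

(* [Y] is a version of E(X | G), for [X] with values in [0, +oo]. *)
Definition is_condexp_ge0 (G : set (set Omega)) (X Y : Omega -> \bar R) :=
  [/\ sub_measurable G Y,
      forall w, 0 <= Y w &
      forall A, G A -> \int[P]_(w in A) Y w = \int[P]_(w in A) X w].

(* [Y] is a version of E(X | G) := E(X^+ | G) - E(X^- | G), in the generalized
   sense: [X] need not be integrable, but the difference must make sense almost
   surely.  For nonnegative or integrable [X] this is the usual notion. *)
Definition is_condexp (G : set (set Omega)) (X Y : Omega -> \bar R) :=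
  sub_measurable G Y /\
  exists Yp Yn : Omega -> \bar R,
    [/\ is_condexp_ge0 G X^\+ Yp, is_condexp_ge0 G X^\- Yn,
        {ae P, forall w, Yp w < +oo \/ Yn w < +oo} &
        {ae P, forall w, Y w = Yp w - Yn w}].

End conditional_expectation.

Section martingales.
Context d (Omega : measurableType d) (R : realType) (P : probability Omega R).
Variable G : nat -> set (set Omega).

Definition martingale (M : nat -> Omega -> R) :=
  [/\ adapted G M,
      forall n, P.-integrable setT (EFin \o M n) &
      forall n, is_condexp P (G n) (EFin \o M n.+1) (EFin \o M n)].

(* The localizing times are [nat]-valued; times with values in [nat] and
   infinity would give the same notion, replacing [tau k] by its minimum
   with [k]. *)
Definition local_martingale (M : nat -> Omega -> R) :=
  adapted G M /\
  exists tau : nat -> Omega -> nat,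
    [/\ forall k, stopping_time G (tau k),
        {ae P, forall w, forall k, (tau k w <= tau k.+1 w)%N},
        {ae P, forall w, (fun k => tau k w) @ \oo --> \oo} &
        forall k, martingale (fun n w => M (minn n (tau k w)) w)].

(* [zeta] is indexed by n >= 1; [zeta 0] is irrelevant. *)
Definition martingale_increments (zeta : nat -> Omega -> R) :=
  forall n, (1 <= n)%N ->
    [/\ sub_measurable (G n) (zeta n),
        exists2 Y, is_condexp P (G n.-1) (fun w => `|zeta n w|%:E) Y
                 & {ae P, forall w, (Y w < +oo)%E} &
        is_condexp P (G n.-1) (EFin \o zeta n) (cst 0%E)].

End martingales.

Definition cosh (R : realType) (x : R) : R := (expR x + expR (- x)) / 2.

Definition predictable_sum (Omega : Type) (R : realType) (s : nat -> Omega -> R)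
    (n : nat) (w : Omega) : R :=
  \sum_(1 <= k < n.+1) s k.-1 w ^+ 2.

Definition Gamma_const (R : realType) (mu gamma lambda : R) : R :=
  (1 + 2 * gamma) / (2 * (mu - lambda)).

Definition c_const (R : realType) (mu gamma lambda : R) : R :=
  let g := Gamma_const mu gamma lambda in
  expR (lambda * g / (2 * (1 - 2 * lambda * g))) * (expR (lambda * g) - 1).

Definition c'_const (R : realType) (mu gamma lambda : R) : R :=
  let q := (gamma - 1) * lambda ^+ 2 / mu ^+ 2 in
  q * expR q * cosh (2 * ln 2 + 2 * q).

(* Main.v *)
(* With D_n := V_n / (a + V_n) in [0, 1[, predictable and nondecreasing, and Z_n
   the quantity inside the expectation, Z_n - F_n is a supermartingale for
   F_n := K (exp (lambda Gamma D_n) - 1) in case (i) and F_n := K D_n in case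
   (ii): the factor 1 / (a + V_n) contracts Z, and Z_n can only grow where
   |M_n| / (a + V_n) is bounded, whence the constant K.  Fatou's lemma along
   the times min(T, n) concludes.  Conditional expectations only enter through
   pointwise bounds of Z_(n+1) by A + B zeta + C exp (mu |zeta|^alpha) with
   A, B, C measurable with respect to G_n, so no conditional law is needed. *)
Require Import Defs.
From HB Require Import structures.
From mathcomp Require Import all_boot all_order all_algebra.
From mathcomp Require Import all_classical all_reals all_analysis.
From mathcomp Require Import measurable_realfun.
From mathcomp Require Import ring lra.
Set Implicit Arguments.
Unset Strict Implicit.
Unset Printing Implicit Defensive.
Import Order.TTheory GRing.Theory Num.Theory.
Import numFieldNormedType.Exports.
Local Open Scope classical_set_scope.
Local Open Scope ring_scope.

(** * Exponential and hyperbolic inequalities *)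

(** Both cases reduce to two numbers in [[0, 1]]. With [w = a + V_n] and [s = s_n], put [b = a / w]
    and [t = s^2 / (w + s^2)]. Passing to the new denominator multiplies [M_n / (a + V_n)] by
    [1 - t], while [D_n = 1 - b] and [D_(n+1) - D_n = b t]. In case (i), let [A] be the current
    exponent, [g = lambda Gamma], and [p], [q] the coefficients of [zeta^2] and [zeta] in the next
    exponent. The conditional mean of [exp (p zeta^2 + q zeta)] is at most [exp (Gamma (p + q^2))];
    here [Gamma p] is of order [g b t], but [Gamma q^2] is proportional to [A] and competes with the
    contraction. The net drift of the exponent is at most [t (1 - t) (g b - 2 (1 - 2 g) A)]. Since
    [2 g < 1], growth forces [A < g / (2 (1 - 2 g))], which is the exponent in [c_lambda]. The
    analytic obstacle is that [B] is unbounded, so [B zeta] need not be integrable. Only integrals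
    of nonnegative functions are compared, and finite ones are cancelled on sets where [B] is
    bounded. *)

Section exponential_bounds.
Context {R : realType}.
Implicit Types (x y z p q mu gamma lambda : R).

Lemma expR_le_invr1B x : x < 1 -> expR x <= (1 - x)^-1.
Proof.
move=> x1; have h : 0 < 1 - x by lra.
rewrite -[expR x]invrK -expRN lef_pV2 ?posrE ?expR_gt0//.
exact: expR_ge1Dx.
Qed.

Lemma expR_le_id_expR_sqr x : expR x <= x + expR (2 * x ^+ 2).
Proof.
(* [1/2] is where both arguments stop: [x <= 2 x^2] for [x >= 1/2], and [(1 - x) (1 + x + 2 x^2) = 1
   + x^2 (1 - 2 x)] is at least [1] for [x <= 1/2]. *)
have [x2|x2] := leP (2^-1) x.
  have : expR x <= expR (2 * x ^+ 2) by rewrite ler_expR; nra.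
  by lra.
have h := expR_ge1Dx (2 * x ^+ 2).
suff : expR x <= 1 + x + 2 * x ^+ 2 by lra.
apply: (le_trans (expR_le_invr1B _)); first lra.
have d : 0 < 1 - x by lra.
by rewrite -div1r ler_pdivrMr//; nra.
Qed.

Lemma expRD_le_expR_sqr y x : 0 <= y ->
  expR (y + x) <= x + expR (2 * (y + x ^+ 2)).
Proof.
move=> y0; have hx := expR_le_id_expR_sqr x.
have y1 : 1 <= expR y by rewrite -[leLHS]expR0 ler_expR.
have x21 : 1 <= expR (2 * x ^+ 2).
  by rewrite -[leLHS]expR0 ler_expR mulr_ge0 ?sqr_ge0.
have xx : x <= expR (2 * x ^+ 2).
  by have := expR_ge1Dx (2 * x ^+ 2); have := sqr_ge0 (x - 4^-1); nra.
rewrite mulrDr 2!expRD (_ : 2 * y = y + y) ?expRD; last by ring.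
move: (expR (2 * x ^+ 2)) (expR x) (expR y) hx y1 x21 xx.
move=> e2 ex ey hx y1 x21 xx.
(* The sum of the three products is exactly [x + e2 * ey ^+ 2 - ey * ex], the quantity to be shown
   nonnegative. *)
have h1 : 0 <= ey * (x + e2 - ex) by apply: mulr_ge0; lra.
have h2 : 0 <= (ey - 1) * (e2 - x) by apply: mulr_ge0; lra.
have h3 : 0 <= e2 * (ey - 1) ^+ 2 by apply: mulr_ge0; rewrite ?sqr_ge0; lra.
by nra.
Qed.

(** Turns the [ln gamma] produced by interpolation into the term linear in [gamma] of
    [Gamma_const]. *)
Lemma ln_le_half x : 0 < x -> ln x <= x / 2.
Proof.
move=> x0; rewrite -ler_expR lnK ?posrE//.
have h := expR_ge1Dx (x / 4).
have -> : x / 2 = 2%:R * (x / 4) by field.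
rewrite expRM_natl; apply: (@le_trans _ _ ((1 + x / 4) ^+ 2)).
  by have := sqr_ge0 (1 - x / 4); nra.
by rewrite lerXn2r ?nnegrE ?expR_ge0//; lra.
Qed.

(** Tangent at [t * x], evaluated at [0] and at [x]: with weights [1 - t] and [t] the slope terms
    cancel. *)
Lemma expR_convex_le (t x : R) : 0 <= t <= 1 ->
  expR (t * x) <= 1 - t + t * expR x.
Proof.
move=> /andP[t0 t1].
have h0 : expR (t * x) * (1 - t * x) <= 1.
  rewrite -[leRHS](expRxMexpNx_1 (t * x)) ler_wpM2l ?expR_ge0//.
  exact: expR_ge1Dx.
have h1 : expR (t * x) * (1 + (1 - t) * x) <= expR x.
  rewrite -[in leRHS](_ : t * x + (1 - t) * x = x); last by ring.
  by rewrite expRD ler_wpM2l ?expR_ge0// expR_ge1Dx.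
have := ler_wpM2l t0 h1; have := ler_wpM2l (_ : 0 <= 1 - t) h0.
by rewrite subr_ge0 => /(_ t1); lra.
Qed.

(** Comparison of the exponential series term by term: for [n >= 2],
    [y^n <= (eta z)^n <= eta^2 z^n]. The term of degree one is kept as [y] itself, so that it
    averages to zero, and the scale enters through [eta^2]. *)
Lemma expR_sub_le (eta z y : R) : 0 <= eta <= 1 -> 0 <= z -> `|y| <= eta * z ->
  expR y <= 1 - eta ^+ 2 + y + eta ^+ 2 * expR z.
Proof.
move=> /andP[e0 e1] z0 yez.
have e2 : 0 <= eta ^+ 2 <= 1 by rewrite sqr_ge0 expr_le1.
have key n : (2 <= n)%N -> series (exp_coeff y) n <=
    1 - eta ^+ 2 + y + eta ^+ 2 * series (exp_coeff z) n.
  elim: n => // -[|[|n]] // IH _.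
    rewrite /series/= !big_nat_recl//= !big_nil /exp_coeff/=.
    have f0 : 0`!%:R = 1 :> R by []. have f1 : 1`!%:R = 1 :> R by [].
    rewrite ?f0 ?f1 !divr1 !expr0 !expr1.
    by have := mulr_ge0 (sqr_ge0 eta) z0; nra.
  rewrite /series/= !(big_nat_recr n.+2)//=.
  move: IH => /(_ isT); rewrite /series /=; set a := \sum_(_ <= _ < _) _.
  set b := \sum_(_ <= _ < _) _ => IH.
  suff : exp_coeff y n.+2 <= eta ^+ 2 * exp_coeff z n.+2 by lra.
  rewrite /exp_coeff/= mulrA ler_wpM2r ?invr_ge0//.
  apply: (le_trans (ler_norm _)); rewrite normrX.
  apply: (le_trans (lerXn2r _ _ _ yez)); rewrite ?nnegrE ?mulr_ge0//.
  rewrite exprMn ler_wpM2r ?exprn_ge0//.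
  by rewrite ler_wiXn2l.
have cy := is_cvg_series_exp_coeff y; have cz := is_cvg_series_exp_coeff z.
have -> : 1 - eta ^+ 2 + y + eta ^+ 2 * expR z =
    limn (fun n => 1 - eta ^+ 2 + y + eta ^+ 2 * series (exp_coeff z) n).
  apply/esym/cvg_lim => //; apply: cvgD; first exact: cvg_cst.
  by apply: cvgMr; exact: cz.
apply: ler_lim => //.
  apply: is_cvgD; first exact: is_cvg_cst.
  by apply: is_cvgMr; exact: cz.
by near=> n; apply: key; near: n; exists 2%N.
Unshelve. all: by end_near. Qed.

(* With theta <= 1, tangent of x |-> x^theta at x = gamma, applied to
   x = exp (mu z^2); otherwise completion of the square. *)
Definition gauss_cst mu gamma p q : R :=
  let theta := 2 * (p + q ^+ 2) / mu in
  if theta <= 1 then (1 - theta) * expR (theta * ln gamma) else 0.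

Definition gauss_slope mu gamma p q : R :=
  let theta := 2 * (p + q ^+ 2) / mu in
  if theta <= 1 then theta * expR ((theta - 1) * ln gamma)
  else expR (q ^+ 2 / (4 * (mu - p))).

Lemma gauss_cst_ge0 mu gamma p q : 0 <= gauss_cst mu gamma p q.
Proof.
rewrite /gauss_cst; case: ifP => // h.
by rewrite mulr_ge0 ?subr_ge0 ?expR_ge0.
Qed.

Lemma gauss_slope_ge0 mu gamma p q : 0 < mu -> 0 <= p ->
  0 <= gauss_slope mu gamma p q.
Proof.
move=> mu0 p0; rewrite /gauss_slope; case: ifP => _; last exact: expR_ge0.
by rewrite mulr_ge0 ?expR_ge0// divr_ge0 ?mulr_ge0 ?addr_ge0 ?sqr_ge0// ltW.
Qed.

(** The pointwise bound for case (i): the coefficient of [z] is exactly [q] in both regimes, so the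
    linear term has conditional mean zero and only the mean of [expR (mu * z ^+ 2)] is left to
    control. *)
Lemma expR_gauss_le mu gamma p q z : 0 < mu -> 0 < gamma -> 0 <= p < mu ->
  expR (p * z ^+ 2 + q * z) <=
  gauss_cst mu gamma p q + q * z
    + gauss_slope mu gamma p q * expR (mu * z ^+ 2).
Proof.
move=> mu0 gamma0 /andP[p0 pmu]; rewrite /gauss_cst /gauss_slope.
set theta := 2 * (p + q ^+ 2) / mu.
have theta0 : 0 <= theta.
  by rewrite divr_ge0 ?mulr_ge0 ?addr_ge0 ?sqr_ge0// ltW.
have pz0 : 0 <= p * z ^+ 2 by rewrite mulr_ge0 ?sqr_ge0.
case: ifPn => [theta1|_].
  apply: (le_trans (expRD_le_expR_sqr _ pz0)).
  have -> : 2 * (p * z ^+ 2 + (q * z) ^+ 2) = theta * (mu * z ^+ 2).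
    by rewrite /theta; field; rewrite gt_eqF.
  set w := mu * z ^+ 2; set l := ln gamma.
  have -> : theta * w = theta * l + theta * (w - l) by ring.
  have := @expR_convex_le theta (w - l); rewrite theta0 theta1 => /(_ isT) h.
  have := ler_wpM2l (expR_ge0 (theta * l)) h; rewrite -expRD => h2.
  have -> : (theta - 1) * l = theta * l - l by ring.
  by move: h2; rewrite !expRD; lra.
rewrite add0r -expRD.
have hy : 1 <= expR (p * z ^+ 2) by rewrite -[leLHS]expR0 ler_expR.
(* The linear term is split off before completing the square. For [q * z < 0] this rests on
   [exp x <= x + exp |x|], and the factor [expR (p * z ^+ 2) >= 1] only makes the negative term
   smaller. *)
apply: (@le_trans _ _ (q * z + expR (p * z ^+ 2 + `|q * z|))).
  have [x0|x0] := leP 0 (q * z); first by rewrite ger0_norm// lerDr.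
  rewrite !expRD.
  have := @expR_sub_le 1 `|q * z| (q * z); rewrite ler01 lexx normr_ge0 mul1r.
  rewrite lexx expr1n => /(_ isT isT isT) h.
  have := ler_wpM2l (ltW (expR_gt0 (p * z ^+ 2))) h.
  have : 0 <= (expR (p * z ^+ 2) - 1) * - (q * z) by apply: mulr_ge0; lra.
  by lra.
rewrite lerD2l ler_expR.
have d : 0 < mu - p by rewrite subr_gt0.
rewrite -subr_ge0.
have -> : q ^+ 2 / (4 * (mu - p)) + mu * z ^+ 2 - (p * z ^+ 2 + `|q * z|) =
    (`|q| - 2 * (mu - p) * `|z|) ^+ 2 / (4 * (mu - p)).
  rewrite normrM -[q ^+ 2]real_normK ?num_real// -[z ^+ 2]real_normK ?num_real//.
  by field; rewrite gt_eqF.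
by rewrite divr_ge0 ?sqr_ge0// mulr_ge0// ltW.
Qed.

(** Origin of [Gamma], which is [gamma / (mu - lambda)] plus [1 / (2 (mu - lambda))]. For
    [theta <= 1] the left side collapses to [gamma^theta], and [theta ln gamma <= theta gamma / 2 =
    (gamma / mu) (p + q^2)]. For [theta > 1] the same bound covers [ln gamma], and the second
    summand absorbs [q^2 / (4 (mu - p))]. *)
Lemma gauss_mean_le mu gamma lambda p q : 1 < gamma -> lambda < mu -> 0 < mu ->
  0 <= p <= lambda ->
  gauss_cst mu gamma p q + gauss_slope mu gamma p q * gamma <=
  expR (Gamma_const mu gamma lambda * (p + q ^+ 2)).
Proof.
move=> gamma1 lm mu0 /andP[p0 pl]; rewrite /gauss_cst /gauss_slope.
have lg := ln_le_half (lt_trans ltr01 gamma1).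
have d : 0 < mu - lambda by rewrite subr_gt0.
have q0 := sqr_ge0 q; have l0 : 0 <= lambda := le_trans p0 pl.
have gE u : expR u * gamma = expR (u + ln gamma).
  by rewrite expRD lnK// posrE (lt_trans ltr01).
set G := Gamma_const _ _ _; set theta := 2 * (p + q ^+ 2) / mu.
have G1 : gamma / mu + (2 * (mu - lambda))^-1 <= G.
  have -> : G = gamma / (mu - lambda) + (2 * (mu - lambda))^-1.
    by rewrite /G /Gamma_const; field; rewrite gt_eqF.
  by rewrite lerD2r ler_wpM2l ?lef_pV2 ?posrE//; lra.
have Gq := ler_wpM2r (addr_ge0 p0 q0) G1.
have i0 : 0 < (2 * (mu - lambda))^-1 by rewrite invr_gt0 mulr_gt0.
have theta0 : 0 <= theta by rewrite divr_ge0 ?mulr_ge0 ?addr_ge0// ltW.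
case: ifPn => [theta1|].
  rewrite -mulrA gE.
  have -> : (theta - 1) * ln gamma + ln gamma = theta * ln gamma by ring.
  rewrite -mulrDl subrK mul1r ler_expR; apply: le_trans Gq.
  apply: (le_trans (ler_wpM2l theta0 lg)).
  have -> : theta * (gamma / 2) = gamma / mu * (p + q ^+ 2).
    by rewrite /theta; field; rewrite gt_eqF.
  by rewrite ler_wpM2r ?addr_ge0// lerDl ltW.
rewrite -ltNge => theta1; rewrite add0r gE ler_expR.
apply: le_trans Gq; rewrite [leRHS]mulrDl [leLHS]addrC; apply: lerD.
  apply: (le_trans lg).
  have -> : gamma / mu * (p + q ^+ 2) = theta * (gamma / 2).
    by rewrite /theta; field; rewrite gt_eqF.
  by rewrite ler_peMl ?ltW//; lra.
apply: (@le_trans _ _ ((2 * (mu - lambda))^-1 * q ^+ 2)).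
  rewrite mulrC ler_wpM2r// lef_pV2 ?posrE//; lra.
by rewrite ler_wpM2l// ?lerDr// ltW.
Qed.

(** The [D_n] of the overview, with [w] standing for [a + V_n]. *)
Definition gain a w : R := 1 - a / w.

(** The three summands on the left are the contracted exponent, [Gamma p] and [Gamma q^2] written in
    [b] and [t]. The slack is an explicit polynomial that is [A] times a sum of nonnegative
    terms. *)
Lemma gauss_exponent_le (A g b t : R) : 0 <= A -> 0 <= g -> 2 * g < 1 ->
  0 <= b <= 1 -> 0 <= t <= 1 ->
  A * (1 - t) ^+ 2 + g * (b * (1 - t) * t) + 4 * g * A * (b * (1 - t) ^+ 3 * t)
  <= A + (1 - t) * t * (g * b - 2 * (1 - 2 * g) * A).
Proof.
move=> A0 g0 g1 /andP[b0 b1] /andP[t0 t1]; rewrite -subr_ge0.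
set u := 1 - t; have tE : t = 1 - u by rewrite /u; ring.
have u0 : 0 <= u by rewrite subr_ge0.
have u1 : u <= 1 by rewrite /u; lra.
have -> : A + u * t * (g * b - 2 * (1 - 2 * g) * A) -
  (A * u ^+ 2 + g * (b * u * t) + 4 * g * A * (b * u ^+ 3 * t)) =
  A * (t ^+ 2 + 4 * g * (t * u) * ((1 - b) * u ^+ 2 + t * (1 + u))).
  by rewrite tE; ring.
have h : 0 <= (1 - b) * u ^+ 2 + t * (1 + u).
  by rewrite addr_ge0// mulr_ge0 ?sqr_ge0//; lra.
by rewrite mulr_ge0// addr_ge0 ?sqr_ge0// mulr_ge0 ?mulr_ge0.
Qed.

(** If the drift is positive, then [A < g b / (2 (1 - 2 g))] and [expR A] is below the constant, so
    the growth [expR A * (expR (g * b * t) - 1)] is controlled. The factor [expR (g * (1 - b)) >= 1]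
    then turns it into an increment of [expR (g D)], which telescopes. *)
Lemma expR_gain_le (A g b t : R) : 0 <= A -> 0 <= g -> 2 * g < 1 ->
  0 <= b <= 1 -> 0 <= t <= 1 ->
  expR (A + (1 - t) * t * (g * b - 2 * (1 - 2 * g) * A)) <=
  expR A + expR (g / (2 * (1 - 2 * g))) *
    (expR (g * (1 - b * (1 - t))) - expR (g * (1 - b))).
Proof.
move=> A0 g0 g1 /andP[b0 b1] /andP[t0 t1].
have d0 : 0 < 1 - 2 * g by lra.
have u0 : 0 <= (1 - t) * t by rewrite mulr_ge0// subr_ge0.
have inc : 0 <= expR (g * (1 - b * (1 - t))) - expR (g * (1 - b)).
  by rewrite subr_ge0 ler_expR ler_wpM2l//; nra.
have [h|h] := leP (g * b) (2 * (1 - 2 * g) * A).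
  apply: (@le_trans _ _ (expR A)); last by rewrite lerDl mulr_ge0 ?expR_ge0.
  by rewrite ler_expR gerDl mulr_ge0_le0// subr_le0.
have AK : expR A <= expR (g / (2 * (1 - 2 * g))).
  rewrite ler_expR ler_pdivlMr ?mulr_gt0//.
  have : g * b <= g by rewrite ler_piMr.
  by lra.
apply: (@le_trans _ _ (expR A + expR A * (expR (g * b * t) - 1))).
  have -> : expR A + expR A * (expR (g * b * t) - 1) = expR (A + g * b * t).
    by rewrite expRD; ring.
  rewrite ler_expR lerD2l.
  apply: (@le_trans _ _ ((1 - t) * t * (g * b))).
    rewrite ler_wpM2l// lerBlDr lerDl mulr_ge0// ltW// mulr_gt0//.
  have gb : 0 <= g * b by rewrite mulr_ge0.
  rewrite mulrC ler_wpM2l//; nra.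
have -> : g * (1 - b * (1 - t)) = g * (1 - b) + g * b * t by ring.
have e1 : 1 <= expR (g * b * t) by rewrite -[leLHS]expR0 ler_expR !mulr_ge0.
have e2 : 1 <= expR (g * (1 - b)).
  by rewrite -[leLHS]expR0 ler_expR mulr_ge0// subr_ge0.
rewrite lerD2l expRD; apply: (le_trans (ler_wpM2r _ AK)).
  by rewrite subr_ge0.
by rewrite ler_wpM2l ?expR_ge0//; nra.
Qed.

Lemma gauss_drift_le mu gamma lambda a w m s :
  let G := Gamma_const mu gamma lambda in
  0 <= lambda -> 0 <= G -> 2 * lambda * G < 1 -> 0 < a <= w ->
  expR (lambda * (a * m ^+ 2 / (w + s ^+ 2) ^+ 2)) *
    expR (G * (lambda * a * s ^+ 2 / (w + s ^+ 2) ^+ 2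
               + (2 * lambda * a * m * s / (w + s ^+ 2) ^+ 2) ^+ 2)) <=
  expR (lambda * (a * m ^+ 2 / w ^+ 2)) +
    expR (lambda * G / (2 * (1 - 2 * lambda * G))) *
      (expR (lambda * G * gain a (w + s ^+ 2)) - expR (lambda * G * gain a w)).
Proof.
move=> G l0 G0 lG /andP[a0 aw]; have w0 : 0 < w := lt_le_trans a0 aw.
have s0 := sqr_ge0 s; have ws0 : 0 < w + s ^+ 2 by rewrite ltr_wpDr.
have [wn wsn] : w != 0 /\ w + s ^+ 2 != 0 by rewrite !gt_eqF.
set A := lambda * (a * m ^+ 2 / w ^+ 2).
set b := a / w; set t := s ^+ 2 / (w + s ^+ 2).
have A0 : 0 <= A.
  by rewrite mulr_ge0// divr_ge0 ?sqr_ge0// mulr_ge0 ?sqr_ge0// ltW.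
have g0 : 0 <= lambda * G by rewrite mulr_ge0.
have g1 : 2 * (lambda * G) < 1 by rewrite mulrA.
have b01 : 0 <= b <= 1.
  apply/andP; split; first by apply: divr_ge0; apply: ltW.
  by rewrite ler_pdivrMr// mul1r.
have t01 : 0 <= t <= 1.
  apply/andP; split; first by rewrite divr_ge0// ltW.
  by rewrite ler_pdivrMr// mul1r lerDr ltW.
have -> : gain a w = 1 - b by [].
have -> : gain a (w + s ^+ 2) = 1 - b * (1 - t).
  by rewrite /gain /b /t; field; rewrite wn wsn.
rewrite -(mulrA 2 lambda G) -expRD.
apply: le_trans (expR_gain_le A0 g0 g1 b01 t01); rewrite ler_expR.
apply: le_trans (gauss_exponent_le A0 g0 g1 b01 t01).
rewrite le_eqVlt; apply/orP; left; apply/eqP.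
by rewrite /A /b /t; field; rewrite wn wsn.
Qed.

(** * Hyperbolic cosine: one-step bound and drift for case (ii) *)

Lemma coshN x : cosh (- x) = cosh x.
Proof. by rewrite /cosh opprK addrC. Qed.

Lemma cosh_ge1 x : 1 <= cosh x.
Proof.
rewrite /cosh ler_pdivlMr// mul1r.
have := expR_ge1Dx x; have := expR_ge1Dx (- x); lra.
Qed.

Lemma ler_cosh x y : 0 <= x -> x <= y -> cosh x <= cosh y.
Proof.
move=> x0 xy; rewrite /cosh ler_pM2r//.
have y0 := le_trans x0 xy.
have h1 : expR x <= expR y by rewrite ler_expR.
have h2 : 1 <= expR x by rewrite -[leLHS]expR0 ler_expR.
rewrite !expRN -subr_ge0.
have ex : expR x != 0 by rewrite gt_eqF ?expR_gt0.
have ey : expR y != 0 by rewrite gt_eqF ?expR_gt0.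
have -> : expR y + (expR y)^-1 - (expR x + (expR x)^-1) =
  (expR y - expR x) * (expR y * expR x - 1) / (expR x * expR y).
  by field; rewrite ex ey.
by rewrite divr_ge0 ?mulr_ge0 ?expR_ge0 ?subr_ge0//; nra.
Qed.

(** [expR_sub_le] at [y] and at [- y], weighted by [expR u] and [expR (- u)]. The linear term comes
    out as [sinh u * y]. *)
Lemma coshD_le (u eta z y : R) : 0 <= eta <= 1 -> 0 <= z -> `|y| = eta * z ->
  cosh (u + y) <= cosh u * (1 - eta ^+ 2)
    + (expR u - expR (- u)) / 2 * y + cosh u * eta ^+ 2 * expR z.
Proof.
move=> eta01 z0 yz.
have h1 : expR y <= 1 - eta ^+ 2 + y + eta ^+ 2 * expR z.
  by apply: expR_sub_le => //; rewrite yz.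
have h2 : expR (- y) <= 1 - eta ^+ 2 - y + eta ^+ 2 * expR z.
  by apply: expR_sub_le => //; rewrite normrN yz.
have k1 := ler_wpM2l (expR_ge0 u) h1; have k2 := ler_wpM2l (expR_ge0 (- u)) h2.
by rewrite /cosh opprD !expRD; lra.
Qed.

Lemma coshD_ge (v h : R) : cosh v + (expR v - expR (- v)) / 2 * h <= cosh (v + h).
Proof.
have k1 := ler_wpM2l (expR_ge0 v) (expR_ge1Dx h).
have k2 := ler_wpM2l (expR_ge0 (- v)) (expR_ge1Dx (- h)).
by rewrite /cosh opprD !expRD; lra.
Qed.

(* If the left-hand side exceeds [cosh y] then [v = y (1 - t)] satisfies
   [v * sinh v <= q * cosh v], which forces [v <= q + 1]. *)
Lemma cosh_drift_le (q b t y : R) : 0 <= q -> 0 <= b <= 1 -> 0 <= t <= 1 ->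
  cosh (y * (1 - t)) * (1 + q * (b * (1 - t) * t)) <=
  cosh y + q * expR q * cosh (2 * ln 2 + 2 * q) * (b * t).
Proof.
wlog y0 : y / 0 <= y => [hw q0 b01 t01|q0 /andP[b0 b1] /andP[t0 t1]].
  have [/hw->//|/ltW y0] := leP 0 y.
  have := hw (- y); rewrite mulNr !coshN oppr_ge0; exact.
set v := y * (1 - t); set K := q * expR q * _.
have v0 : 0 <= v by rewrite mulr_ge0// subr_ge0.
have K0 : 0 <= K.
  by rewrite !mulr_ge0 ?expR_ge0//; apply: le_trans ler01 (cosh_ge1 _).
have Kbt : 0 <= K * (b * t) by rewrite !mulr_ge0.
have c1 := cosh_ge1 v.
have cy : cosh v + (expR v - expR (- v)) / 2 * (t * y) <= cosh y.
  by have := coshD_ge v (t * y); rewrite (_ : v + t * y = y)// /v; ring.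
set S := (expR v - expR (- v)) / 2 in cy.
have S0 : 0 <= S.
  by rewrite divr_ge0// subr_ge0 ler_expR; lra.
have [h|h] := leP (cosh v * (q * (b * (1 - t) * t))) (S * (t * y)).
  by rewrite mulrDr mulr1; lra.
have u0 : 0 <= 1 - t by rewrite subr_ge0.
have tp : 0 < t.
  rewrite lt_neqAle t0 andbT; apply/eqP => tz.
  by move: h; rewrite -tz !(mul0r, mulr0) ltxx.
have h1 : S * y < cosh v * (q * (b * (1 - t))).
  by rewrite -(ltr_pM2r tp); lra.
have cq0 : 0 <= cosh v * q by rewrite mulr_ge0//; lra.
have h2 : S * v <= q * cosh v.
  have := ler_wpM2r u0 (ltW h1); rewrite -mulrA -/v => /le_trans; apply.
  have -> : cosh v * (q * (b * (1 - t))) * (1 - t)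
    = cosh v * q * (b * ((1 - t) * (1 - t))) by ring.
  rewrite [leRHS]mulrC ler_piMr// mulr_ile1 ?mulr_ge0// mulr_ile1//; lra.
have vle : v <= q + 1.
  (* With [S = sinh v], the bound [v S <= q cosh v] reads [(v - q) cosh v <= v exp (- v)], and
     [v exp (- v) <= 1 <= cosh v]. *)
  have SE : S = cosh v - expR (- v) by rewrite /S /cosh; field.
  have ve : v * expR (- v) <= 1.
    rewrite -[leRHS](expRxMexpNx_1 v) ler_wpM2r ?expR_ge0//.
    by have := expR_ge1Dx v; lra.
  have : (v - 1 - q) * cosh v <= 0.
    by move: h2; rewrite SE; nra.
  by rewrite pmulr_lle0; lra.
(* Gives [q + 1 <= 2 ln 2 + 2 q], the argument of [cosh] in [c'_const]. *)
have l2 : 2^-1 <= ln 2 :> R.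
  rewrite -ler_expR lnK ?posrE//.
  apply: (le_trans (expR_le_invr1B _)); first lra.
  by rewrite -div1r ler_pdivrMr; lra.
have cK : cosh v <= expR q * cosh (2 * ln 2 + 2 * q).
  apply: (@le_trans _ _ (cosh (2 * ln 2 + 2 * q))).
    by apply: ler_cosh => //; lra.
  rewrite ler_peMl//; first exact: le_trans ler01 (cosh_ge1 _).
  by rewrite -[leLHS]expR0 ler_expR.
have qbt : 0 <= q * (b * t) by rewrite !mulr_ge0.
have yv : cosh v <= cosh y by apply: ler_cosh => //; rewrite /v; nra.
have := ler_wpM2l qbt cK.
have : cosh v * (q * (b * (1 - t) * t)) <= q * (b * t) * cosh v.
  rewrite -subr_ge0 (_ : _ - _ = cosh v * q * (b * t * t)); last by ring.
  by rewrite mulr_ge0// !mulr_ge0.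
by rewrite /K mulrDr mulr1; lra.
Qed.

End exponential_bounds.

(** * Conditional expectations and optional stopping *)

Section sub_sigma_algebra.
Context d (Omega : measurableType d) (R : realType) (P : probability Omega R).
Variable G : set (set Omega).
Hypotheses (sG : sigma_algebra setT G) (Gm : G `<=` measurable).

Let measurableG (A : set Omega) :
  measurable (A : set (g_sigma_algebraType G)) = G A.
Proof. by rewrite [measurable](@measurable_g_measurableTypeE Omega). Qed.

Lemma sub_measurable_measurable d' (S : measurableType d') (X : Omega -> S) :
  sub_measurable G X -> measurable_fun setT X.
Proof.
move=> mX _ A mA; apply: Gm; rewrite -measurableG.
exact: mX.
Qed.

Import HBNNSimple.
Local Open Scope ereal_scope.

(** The weight is approximated by simple functions on [g_sigma_algebraType G], so that their level
    sets lie in [G] and the defining identity applies to each; monotone convergence does the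
    rest. *)
Lemma condexp_ge0_integralM (X Y : Omega -> \bar R) (B : Omega -> R) D :
  is_condexp_ge0 P G X Y -> measurable_fun setT X -> (forall w, 0 <= X w) ->
  sub_measurable G B -> (forall w, (0 <= B w)%R) -> G D ->
  \int[P]_(w in D) ((B w)%:E * X w) = \int[P]_(w in D) ((B w)%:E * Y w).
Proof.
move=> [mY Y0 XY] mX X0 mB B0 GD.
have {}mY := sub_measurable_measurable mY.
have mD := Gm GD.
have mT : measurable [set: g_sigma_algebraType G] by [].
have mEB : measurable_fun [set: g_sigma_algebraType G]
    (EFin \o (B : g_sigma_algebraType G -> R)).
  exact/measurable_EFinP.
pose h : {nnsfun g_sigma_algebraType G >-> R}^nat := nnsfun_approx mT mEB.
have mh n : measurable_fun setT (h n : Omega -> R).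
  by apply: sub_measurable_measurable; exact: measurable_funP.
have Bh (Z : Omega -> \bar R) : measurable_fun setT Z -> (forall w, 0 <= Z w) ->
    \int[P]_(w in D) ((B w)%:E * Z w) =
    limn (fun n => \int[P]_(w in D) ((h n w)%:E * Z w)).
  move=> mZ Z0; rewrite -monotone_convergence//.
  - apply: eq_integral => w _; apply/esym/cvg_lim => //.
    have hB := cvg_nnsfun_approx mT mEB (fun w _ => B0 w) (x := w) Logic.I.
    (* [Z w] may be infinite, and continuity of the product excludes [0 * +oo]. Where [B w = 0] the
       approximations from below vanish too, so the product is constantly [0]. *)
    have [Bw|Bw] := eqVneq (B w) 0%R; last first.
      apply: cvgeM => //; last exact: cvg_cst.
      by rewrite /mule_def; case: (Z w).
    have hw n : h n w = 0%R.
      apply/le_anti/andP; split => //; rewrite -lee_fin -Bw /h nnsfun_approxE.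
      by apply: le_approx => // v _; rewrite lee_fin.
    have -> : (fun n => (h n w)%:E * Z w) = cst 0.
      by apply/funext => n; rewrite hw mul0e.
    by rewrite [X in _ --> X](_ : _ = 0) ?Bw ?mul0e//; exact: cvg_cst.
  - move=> n; apply: emeasurable_funM; apply: measurable_funTS => //.
    exact/measurable_EFinP.
  - by move=> n w _; rewrite mule_ge0 ?lee_fin.
  - move=> w _ m n mn; rewrite lee_wpmul2r// lee_fin.
    by have /lefP := nd_nnsfun_approx mT mEB mn; exact.
rewrite !Bh//; congr (limn _); apply/funext => n.
have hE (Z : Omega -> \bar R) : measurable_fun setT Z -> (forall w, 0 <= Z w) ->
    \int[P]_(w in D) ((h n w)%:E * Z w) =
    \sum_(y \in range (h n)) (y%:E * \int[P]_(w in D `&` h n @^-1` [set y]) Z w).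
  move=> mZ Z0.
  transitivity (\int[P]_(w in D) (\sum_(y \in range (h n))
     (y * \1_(h n @^-1` [set y]) w)%:E * Z w)).
    apply: eq_integral => w _; rewrite -ge0_mule_fsuml => [|y]; last first.
      exact: nnfun_muleindic_ge0.
    by rewrite fsumEFin//; congr (_%:E * _); rewrite [LHS]fimfunE.
  have mI y : measurable (h n @^-1` [set y] : set Omega).
    by apply: Gm; rewrite -measurableG; exact: measurable_sfunP.
  have mf y : measurable_fun D (fun w => (y * \1_(h n @^-1` [set y]) w)%:E * Z w).
    apply: measurable_funTS; apply: emeasurable_funM => //.
    by apply/measurable_EFinP; apply: measurable_funM.
  rewrite ge0_integral_fsum//; last first.
    by move=> y w _; rewrite mule_ge0//; exact: nnfun_muleindic_ge0.
  apply: eq_fsbigr => r rhn.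
  under eq_integral do rewrite EFinM -muleA.
  rewrite ge0_integralZl//.
  - rewrite integral_mkcondr; congr (_ * _); apply: eq_integral => x xE.
    by rewrite epatch_indic muleC.
  - apply: measurable_funTS; apply: emeasurable_funM => //.
    exact/measurable_EFinP.
  - by move=> t Et; rewrite mule_ge0 ?lee_fin.
  - by move: rhn; rewrite inE => -[t _ <-]; rewrite lee_fin.
rewrite !hE//; apply: eq_fsbigr => r _; rewrite XY//.
rewrite -measurableG; apply: measurableI; first by rewrite measurableG.
exact: measurable_sfunP.
Qed.

Lemma condexp_le_integralM (X Y : Omega -> \bar R) (C : Omega -> R) c D :
  is_condexp P G X Y -> measurable_fun setT X -> (forall w, 0 <= X w) ->
  {ae P, forall w, Y w <= c%:E} -> (0 <= c)%R ->
  sub_measurable G C -> (forall w, (0 <= C w)%R) -> G D ->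
  \int[P]_(w in D) ((C w)%:E * X w) <= \int[P]_(w in D) (C w * c)%:E.
Proof.
move=> [_ [Yp [Yn [cYp cYn YpYn YE]]]] mX X0 Yc c0 mC C0 GD.
have mD := Gm GD; have mC' := sub_measurable_measurable mC.
have [mYp Yp0 _] := cYp; have [mYn Yn0 _] := cYn.
have {}mYp := sub_measurable_measurable mYp.
have {}mYn := sub_measurable_measurable mYn.
have mCE : measurable_fun D (fun w => (C w)%:E).
  exact/measurable_EFinP/measurable_funTS.
have mCYn : measurable_fun D (fun w => (C w)%:E * Yn w).
  by apply: emeasurable_funM => //; exact: measurable_funTS.
have mCc : measurable_fun D (fun w => (C w * c)%:E).
  by apply/measurable_EFinP/measurable_funTS; exact: measurable_funM.
have -> : \int[P]_(w in D) ((C w)%:E * X w) = \int[P]_(w in D) ((C w)%:E * Yp w).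
  rewrite -(condexp_ge0_integralM cYp)//; last exact: measurable_funepos.
  by apply: eq_integral => w _; rewrite (ge0_funeposE (D := setT)) ?inE.
have Yn_int : \int[P]_(w in D) ((C w)%:E * Yn w) = 0.
  rewrite -(condexp_ge0_integralM cYn)//; last exact: measurable_funeneg.
  by apply: integral0_eq => w _; rewrite (ge0_funenegE (D := setT)) ?inE ?mule0.
(* Adding the null integral of [C * Yn] on the right leaves [Yp <= c + Yn] to be checked, which is
   meaningful even where [Yn] is infinite. *)
rewrite -[leRHS]adde0 -Yn_int -ge0_integralD//; last 2 first.
  by move=> w _; rewrite lee_fin mulr_ge0.
  by move=> w _; rewrite mule_ge0 ?lee_fin.
apply: ae_ge0_le_integral => //.
- by move=> w _; rewrite mule_ge0 ?lee_fin.
- by apply: emeasurable_funM => //; exact: measurable_funTS.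
- by move=> w _; rewrite adde_ge0 ?mule_ge0 ?lee_fin ?mulr_ge0.
- exact: emeasurable_funD.
move: Yc YE; apply: filterS2 => w Yw YEw _; rewrite YEw in Yw.
rewrite EFinM -ge0_muleDr ?lee_fin// lee_wpmul2l ?lee_fin//.
move: Yw (Yn0 w); case: (Yn w) => [r||].
- by rewrite leeBlDr.
- by move=> _ _; rewrite addey// leey.
- by [].

Qed.

(** Stated as an equality of two possibly infinite integrals, so that [B * Z] need not be
    integrable. It holds because [Yp - Yn = 0] with one of the two finite gives [Yp = Yn] almost
    surely. *)
Lemma condexp0_integralM (Z B : Omega -> R) D :
  is_condexp P G (EFin \o Z) (cst 0) -> measurable_fun setT Z ->
  sub_measurable G B -> (forall w, (0 <= B w)%R) -> G D ->
  \int[P]_(w in D) (B w * Num.max (Z w) 0)%:E =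
  \int[P]_(w in D) (B w * Num.max (- Z w) 0)%:E.
Proof.
move=> [_ [Yp [Yn [cYp cYn YpYn YE]]]] mZ mB B0 GD.
have mD := Gm GD; have mB' := sub_measurable_measurable mB.
have [mYp Yp0 _] := cYp; have [mYn Yn0 _] := cYn.
have {}mYp := sub_measurable_measurable mYp.
have {}mYn := sub_measurable_measurable mYn.
have mZE : measurable_fun setT (EFin \o Z) by exact/measurable_EFinP.
transitivity (\int[P]_(w in D) ((B w)%:E * Yp w)).
  rewrite -(condexp_ge0_integralM cYp)//; last exact: measurable_funepos.
  by apply: eq_integral => w _; rewrite funeposE/= EFinM EFin_max.
transitivity (\int[P]_(w in D) ((B w)%:E * Yn w)); last first.
  rewrite -(condexp_ge0_integralM cYn)//; last exact: measurable_funeneg.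
  by apply: eq_integral => w _; rewrite funenegE/= EFinM EFin_max.
apply: ge0_ae_eq_integral => //.
- apply: emeasurable_funM; apply: measurable_funTS => //.
  exact/measurable_EFinP.
- apply: emeasurable_funM; apply: measurable_funTS => //.
  exact/measurable_EFinP.
- by move=> w _; rewrite mule_ge0 ?lee_fin.
- by move=> w _; rewrite mule_ge0 ?lee_fin.
move: YpYn YE; apply: filterS2 => w h /= Yw _; congr (_ * _).
move: h Yw (Yp0 w) (Yn0 w); case: (Yp w) => [p||]; case: (Yn w) => [n||]//=.
  by move=> _ /eqP; rewrite -EFinB eqe eq_sym subr_eq0 => /eqP ->.
Qed.

(** Carries the pointwise bounds to integrals over sets of [G]: the term in [Z] averages to zero and
    [X] is replaced by [c]. [B] has any sign and no bound, hence the splitting into positive and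
    negative parts and the truncation. *)
Lemma condexp_integral_le (X Z A B C f g : Omega -> R) (Y : Omega -> \bar R) c D :
  is_condexp P G (EFin \o X) Y -> measurable_fun setT X ->
  (forall w, (0 <= X w)%R) -> {ae P, forall w, Y w <= c%:E} -> (0 <= c)%R ->
  is_condexp P G (EFin \o Z) (cst 0) -> P.-integrable setT (EFin \o Z) ->
  sub_measurable G A -> sub_measurable G B -> sub_measurable G C ->
  (forall w, (0 <= A w)%R) -> (forall w, (0 <= C w)%R) ->
  measurable_fun setT f -> measurable_fun setT g -> (forall w, (0 <= f w)%R) ->
  {ae P, forall w, (f w <= A w + B w * Z w + C w * X w)%R} ->
  (forall w, (A w + C w * c <= g w)%R) -> G D ->
  \int[P]_(w in D) (f w)%:E <= \int[P]_(w in D) (g w)%:E.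
Proof.
move=> cX mX X0 Yc c0 cZ iZ mA mB mC A0 C0 mf mg f0 fle gle GD.
have g0 w : (0 <= g w)%R by apply: le_trans (gle w); rewrite addr_ge0 ?mulr_ge0.
have mZ : measurable_fun setT Z by exact/measurable_EFinP/(measurable_int _ iZ).
have mA' := sub_measurable_measurable mA.
have mB' := sub_measurable_measurable mB.
have mC' := sub_measurable_measurable mC.
pose Bp w : R := Num.max (B w) 0%R; pose Bn w : R := Num.max (- B w)%R 0%R.
pose Zp w : R := Num.max (Z w) 0%R; pose Zn w : R := Num.max (- Z w)%R 0%R.
have pos (x : R) : (0 <= Num.max x 0)%R by rewrite le_max lexx orbT.
have max_le_norm (x : R) : (Num.max x 0 <= `|x|)%R.
  by rewrite ge_max ler_norm normr_ge0.
have normE (x : R) : (`|x| = Num.max (- x) 0 + Num.max x 0)%R.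
  have /orP[x0|x0] := le_total 0%R x.
    by rewrite ger0_norm// max_r ?oppr_le0// max_l// add0r.
  by rewrite ler0_norm// max_l ?oppr_ge0// max_r// addr0.
have posE (x : R) : (x = Num.max x 0 - Num.max (- x) 0)%R.
  have /orP[x0|x0] := le_total 0%R x.
    by rewrite max_l// max_r ?oppr_le0// subr0.
  by rewrite max_r// max_l ?oppr_ge0// sub0r opprK.
have mpos d' (T' : measurableType d') (h : T' -> R) :
    measurable_fun setT h -> measurable_fun setT (fun w => Num.max (h w) 0)%R.
  by move=> mh; apply: measurable_maxr.
have mneg d' (T' : measurableType d') (h : T' -> R) :
    measurable_fun setT h -> measurable_fun setT (fun w => Num.max (- h w) 0)%R.
  by move=> mh; apply: mpos; exact: measurable_funN.
have mBp : sub_measurable G Bp by exact: mpos.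
have mBn : sub_measurable G Bn by exact: mneg.
have [mBp' mBn'] : measurable_fun setT Bp /\ measurable_fun setT Bn.
  by split; [exact: mpos|exact: mneg].
have [mZp mZn] : measurable_fun setT Zp /\ measurable_fun setT Zn.
  by split; [exact: mpos|exact: mneg].
(* These sets stay in [G] because [B] is measurable for it, and they increase to [D]. *)
pose D_ n := D `&` [set w | (`|B w| <= n%:R)%R].
have GD_ n : G (D_ n).
  rewrite -measurableG; apply: measurableI; first by rewrite measurableG.
  have mnB : measurable_fun [set: g_sigma_algebraType G] (fun w => `|B w|)%R.
    exact: measurableT_comp.
  rewrite -[X in measurable X]setTI.
  have := mnB measurableT `]-oo, n%:R]%classic (measurable_itv _).
  by congr measurable; apply/seteqP; split => w /=; rewrite in_itv.
have mD_ n := Gm (GD_ n).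
have step n : \int[P]_(w in D_ n) (f w)%:E <= \int[P]_(w in D) (g w)%:E.
  (* [B Z = K - J] with both nonnegative; exchanging [Zp] and [Zn] under each weight shows that they
     have equal integrals. *)
  pose J w := (Bp w * Zn w + Bn w * Zp w)%R.
  pose K w := (Bp w * Zp w + Bn w * Zn w)%R.
  have mE (h : Omega -> R) : measurable_fun setT h ->
      measurable_fun (D_ n) (fun w => (h w)%:E).
    by move=> mh; apply/measurable_EFinP/measurable_funTS.
  have mM (h k : Omega -> R) : measurable_fun setT h -> measurable_fun setT k ->
      measurable_fun setT (fun w => h w * k w)%R by exact: measurable_funM.
  have mD (h k : Omega -> R) : measurable_fun setT h -> measurable_fun setT k ->
      measurable_fun setT (fun w => h w + k w)%R by exact: measurable_funD.
  have J0 w : (0 <= J w)%R by rewrite addr_ge0// mulr_ge0 ?pos.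
  have K0 w : (0 <= K w)%R by rewrite addr_ge0// mulr_ge0 ?pos.
  have mJ : measurable_fun setT J by apply: mD; exact: mM.
  have mK : measurable_fun setT K by apply: mD; exact: mM.
  have JK : \int[P]_(w in D_ n) (J w)%:E = \int[P]_(w in D_ n) (K w)%:E.
    under eq_integral do rewrite EFinD.
    under [RHS]eq_integral do rewrite EFinD.
    rewrite !ge0_integralD//; try (by move=> w _; rewrite lee_fin mulr_ge0 ?pos);
      try exact/mE/mM.
    by rewrite !(condexp0_integralM cZ)// => w; exact: pos.
  have Jfin : \int[P]_(w in D_ n) (J w)%:E \is a fin_num.
    rewrite ge0_fin_numE; last by apply: integral_ge0 => w _; rewrite lee_fin.
    have /integrableP[_ Zoo] := iZ.
    apply: (@le_lt_trans _ _ (n%:R%:E * \int[P]_w `|(EFin \o Z) w|)); last first.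
      by rewrite lte_mul_pinfty ?lee_fin.
    have mnZ : measurable_fun setT (fun w => `|(EFin \o Z) w|).
      by apply: measurableT_comp => //; exact/measurable_EFinP.
    rewrite -ge0_integralZl ?lee_fin//.
    apply: (@le_trans _ _ (\int[P]_(w in D_ n) (n%:R%:E * `|(EFin \o Z) w|))).
      apply: ge0_le_integral => //.
      - by move=> w _; rewrite lee_fin.
      - exact: mE.
      - by apply: measurable_funTS; exact: measurable_funeM.
      move=> w [_ /= Bw]; rewrite lee_fin /J (normE (Z w)) mulrDr.
      apply: lerD; rewrite ler_wpM2r ?pos//; apply: (le_trans _ Bw).
        exact: max_le_norm.
      by rewrite -normrN; exact: max_le_norm.
    by apply: ge0_subset_integral => //; exact: measurable_funeM.
  (* The inequality is used as [f + J <= A + C X + K], all terms nonnegative. The common integral is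
     at most [n] times that of [|Z|], hence finite, and cancels. *)
  rewrite -(leeD2rE _ _ Jfin) [in leRHS]JK.
  rewrite -ge0_integralD//; try (by move=> w _; rewrite lee_fin);
    try exact: mE.
  apply: (@le_trans _ _ (\int[P]_(w in D_ n) ((A w + C w * X w)%:E + (K w)%:E))).
    apply: ae_ge0_le_integral => //.
    - by move=> w _; rewrite adde_ge0 ?lee_fin.
    - by apply: emeasurable_funD; exact: mE.
    - by move=> w _; rewrite adde_ge0 ?lee_fin// addr_ge0 ?mulr_ge0.
    - by apply: emeasurable_funD; apply: mE => //; apply: mD => //; exact: mM.
    apply: filterS fle => w fw _; rewrite -!EFinD lee_fin.
    rewrite (posE (B w)) (posE (Z w)) -/(Bp w) -/(Bn w) -/(Zp w) -/(Zn w) in fw.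
    by rewrite /J /K; lra.
  rewrite ge0_integralD//; last 4 first.
  - by move=> w _; rewrite lee_fin addr_ge0 ?mulr_ge0.
  - by apply: mE; apply: mD => //; exact: mM.
  - by move=> w _; rewrite lee_fin.
  - exact: mE.
  rewrite leeD2r//.
  under eq_integral do rewrite EFinD.
  rewrite ge0_integralD//; last 4 first.
  - by move=> w _; rewrite lee_fin.
  - exact: mE.
  - by move=> w _; rewrite lee_fin mulr_ge0.
  - exact/mE/mM.
  under [X in _ + X <= _]eq_integral do rewrite EFinM.
  have mEX : measurable_fun setT (EFin \o X) by exact/measurable_EFinP.
  have XE0 w : 0 <= (EFin \o X) w by rewrite lee_fin.
  apply: (le_trans (leeD2l _ (condexp_le_integralM cX mEX XE0 Yc c0 mC C0 (GD_ n)))).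
  rewrite -ge0_integralD//; last 4 first.
  - by move=> w _; rewrite lee_fin.
  - exact: mE.
  - by move=> w _; rewrite lee_fin mulr_ge0.
  - by apply: mE; exact: mM.
  apply: (@le_trans _ _ (\int[P]_(w in D_ n) (g w)%:E)).
    apply: ge0_le_integral => //.
    - by move=> w _; rewrite adde_ge0 ?lee_fin ?mulr_ge0.
    - by apply: emeasurable_funD; apply: mE => //; exact: mM.
    - exact: mE.
    - by move=> w _; rewrite -EFinD lee_fin.
  apply: ge0_subset_integral => //; first exact: Gm.
    exact/measurable_EFinP/measurable_funTS.
    by move=> w _; rewrite lee_fin.
  by move=> w [].
have DE : D = \bigcup_n D_ n.
  apply/seteqP; split => [w Dw|w [k _ [Dw _]]//].
  exists (Num.truncn `|B w|).+1 => //; split => //=.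
  by rewrite ltW// truncnS_gt.
have cvgf : \int[P]_(w in D_ i) (f w)%:E @[i --> \oo] -->
    \int[P]_(w in \bigcup_i D_ i) (f w)%:E.
  apply: ge0_nondecreasing_set_cvg_integral => //.
  - move=> i j ij; rewrite subsetEset => w [Dw /= Bw]; split => //=.
    by rewrite (le_trans Bw)// ler_nat.
  - by move=> i; exact/measurable_EFinP/measurable_funTS.
  - by move=> i w _; rewrite lee_fin.
rewrite -DE in cvgf; rewrite -(cvg_lim _ cvgf)//; apply: lime_le.
  exact: (cvgP _ cvgf).
by apply: nearW.
Qed.

End sub_sigma_algebra.

(** * Optional stopping for nonnegative supermartingales, in integral form *)

Section optional_stopping.
Context d (Omega : measurableType d) (R : realType) (P : probability Omega R).
Variables (G : nat -> set (set Omega)) (U : nat -> Omega -> R).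
Hypotheses (hG : filtration G) (mU : forall n, measurable_fun setT (U n))
  (U0 : forall n w, 0 <= U n w).
Local Open Scope ereal_scope.
Hypothesis U_decr : forall n D, G n D ->
  \int[P]_(w in D) (U n.+1 w)%:E <= \int[P]_(w in D) (U n w)%:E.
Variables (T : Omega -> nat) (hT : stopping_time G T).

Let S n w := U (minn n (T w)) w.

Let SS n w : S n.+1 w = if (T w <= n)%N then S n w else U n.+1 w.
Proof.
rewrite /S; case: ifPn => [Tn|].
  by rewrite (minn_idPr Tn) (minn_idPr (leq_trans Tn (leqnSn n))).
by rewrite -ltnNge => /minn_idPl ->.
Qed.

Let Tgt n : G n (~` [set w | (T w <= n)%N]).
Proof.
have [sG _ _] := hG; have [_ GC _] := sG n.
by rewrite -setTD; exact/GC/hT.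
Qed.

Let mT n : measurable [set w | (T w <= n)%N].
Proof. by have [_ Gm _] := hG; apply: Gm; exact: hT. Qed.

Let S_ge0 n w : (0 <= S n w)%R. Proof. exact: U0. Qed.

Let mS n : measurable_fun setT (S n).
Proof.
elim: n => [|n IH].
  by rewrite (_ : S 0 = U 0%N)//; apply/funext => w; rewrite /S min0n.
rewrite (_ : S n.+1 = fun w => if (T w <= n)%N then S n w else U n.+1 w).
  apply: measurable_fun_ifT => //; apply: (measurable_fun_bool true) => //.
  by rewrite setTI; exact: mT.
by apply/funext => w; rewrite SS.
Qed.

(** The stopped process is frozen where [T <= n]; the complement belongs to [G n], so [U_decr]
    applies there. *)
Let S_decr n : \int[P]_w (S n.+1 w)%:E <= \int[P]_w (S n w)%:E.
Proof.
have mE (D : set Omega) (h : Omega -> R) : measurable_fun setT h ->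
    measurable_fun D (fun w => (h w)%:E).
  by move=> mh; apply/measurable_EFinP; exact: measurable_funTS.
set A := [set w | (T w <= n)%N].
have mA : measurable A by exact: mT.
have mAc : measurable (~` A) by exact: measurableC.
have -> : [set: Omega] = A `|` ~` A by rewrite setUv.
have dA : [disjoint A & ~` A] by apply/disj_setPS; rewrite setICr.
rewrite !ge0_integral_setU//; try exact: mE;
  try (by move=> w _; rewrite lee_fin).
apply: leeD.
  apply: ge0_le_integral => //; try exact: mE.
  - by move=> w _; rewrite lee_fin.
  - by move=> w; rewrite /A/= => Tn; rewrite SS Tn.
rewrite (eq_integral (fun w => (U n.+1 w)%:E)); last first.
  by move=> w; rewrite inE /A/= => /negP/negbTE Tn; rewrite SS Tn.
rewrite [leRHS](eq_integral (fun w => (U n w)%:E)).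
  exact/U_decr/Tgt.
move=> w; rewrite inE /A/= => /negP; rewrite -ltnNge => Tn.
by rewrite /S (minn_idPl (ltnW Tn)).
Qed.

Lemma measurable_stopped (Z : nat -> Omega -> R) :
  (forall n, measurable_fun setT (Z n)) ->
  measurable_fun setT (fun w => Z (T w) w).
Proof.
move=> mZ _ B mB; rewrite setTI.
have -> : (fun w => Z (T w) w) @^-1` B =
    \bigcup_n ([set w | T w = n] `&` Z n @^-1` B).
  by apply/seteqP; split => [w ZB|w [n _ [/= <-]]//]; exists (T w).
apply: bigcupT_measurable => n; apply: measurableI.
  case: n => [|n].
    rewrite (_ : mkset _ = [set w | (T w <= 0)%N])//.
    by apply/seteqP; split => w /=; rewrite leqn0 => /eqP.
  rewrite (_ : mkset _ = [set w | (T w <= n.+1)%N] `\` [set w | (T w <= n)%N]).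
    exact: measurableD.
  apply/seteqP; split => w /= => [->|[]]; first by rewrite ltnn.
  by rewrite leq_eqVlt ltnS => /predU1P[].
by rewrite -[X in measurable X]setTI; exact: mZ.
Qed.

Lemma stopped_integral_le :
  \int[P]_w (U (T w) w)%:E <= \int[P]_w (U 0%N w)%:E.
Proof.
have S0 n : \int[P]_w (S n w)%:E <= \int[P]_w (U 0%N w)%:E.
  elim: n => [|n]; last exact: le_trans.
  by apply: ge0_le_integral => //; try (by move=> w _; rewrite lee_fin);
    [exact/measurable_EFinP|exact/measurable_EFinP|move=> w _; rewrite /S min0n].
have mSE n : measurable_fun setT (EFin \o S n) by exact/measurable_EFinP.
have SE0 n w : setT w -> 0 <= (EFin \o S n) w by rewrite lee_fin.
apply: le_trans (le_trans (fatou P measurableT mSE SE0) _).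
  rewrite le_eqVlt; apply/orP; left; apply/eqP/eq_integral => w _.
  apply/esym; suff /cvg_limn_einf_sup[] : (EFin \o S n) w @[n --> \oo] -->
    (U (T w) w)%:E by [].
  apply: cvg_near_cst; exists (T w) => // n /= Tn.
  by rewrite /S (minn_idPr Tn).
rewrite limn_einf_lim; apply: lime_le; first exact: is_cvg_einfs.
apply: nearW => n; apply: le_trans (S0 n).
by apply: ereal_inf_lbound; exists n => /=.
Qed.

End optional_stopping.

Section stopped_expectation.
Context d (Omega : measurableType d) (R : realType) (P : probability Omega R).
Variables (G : nat -> set (set Omega)) (zeta : nat -> Omega -> R).
Variables (alpha : nat) (mu gamma : R).
Hypotheses (hG : filtration G) (hzeta : martingale_increments P G zeta).
Hypotheses (alpha0 : (0 < alpha)%N) (mu0 : 0 < mu) (gamma0 : 0 <= gamma).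
Hypothesis hexp : forall k, (1 <= k)%N ->
  exists2 Y, is_condexp P (G k.-1)
               (fun w => (expR (mu * `|zeta k w| ^+ alpha))%:E) Y
           & {ae P, forall w, (Y w <= gamma%:E)%E}.

Let X k w := expR (mu * `|zeta k w| ^+ alpha).

Let mzeta k : (1 <= k)%N -> measurable_fun setT (zeta k).
Proof.
move=> k0; have [sG Gm _] := hG; have [+ _ _] := hzeta k0.
exact: sub_measurable_measurable.
Qed.

Let mX k : (1 <= k)%N -> measurable_fun setT (X k).
Proof.
move=> k0; apply: measurableT_comp => //; apply: measurable_funM => //.
by apply: measurable_funX; apply: measurableT_comp => //; exact: mzeta.
Qed.

(** Martingale increments are centered only in the generalized sense; integrability comes from the
    exponential moment, through [|z| <= 1 + |z|^alpha <= 1 + exp (mu |z|^alpha) / mu]. *)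
Let integrable_zeta k : (1 <= k)%N -> P.-integrable setT (EFin \o zeta k).
Proof.
move=> k0; have [sG Gm _] := hG; have mz := mzeta k0; have mXk := mX k0.
have [Y cY Yg] := hexp k0.
have XE0 w : (0 <= (X k w)%:E)%E by rewrite lee_fin expR_ge0.
have mXE : measurable_fun setT (fun w => (X k w)%:E) by exact/measurable_EFinP.
have GT : G k.-1 setT.
  have [G0 GC _] := sG k.-1; by rewrite -(setD0 setT); exact: GC.
have mc : sub_measurable (G k.-1) (fun _ : Omega => mu^-1).
  exact: measurable_cst.
have mu10 : 0 <= mu^-1 by rewrite invr_ge0 ltW.
have XI := condexp_le_integralM (sG k.-1) (Gm k.-1) cY mXE XE0 Yg gamma0 mc
  (fun=> mu10) GT.
rewrite integral_cst//= in XI.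
apply/integrableP; split; first exact/measurable_EFinP.
apply: (@le_lt_trans _ _ (\int[P]_w (1%:E + (mu^-1)%:E * (X k w)%:E))%E).
  apply: ge0_le_integral => //.
  - by apply: measurableT_comp => //; exact/measurable_EFinP.
  - by apply: emeasurable_funD => //; exact: measurable_funeM.
  move=> w _; rewrite -EFinM -EFinD lee_fin /X.
  set z := `|zeta k w|; have z0 : 0 <= z by exact: normr_ge0.
  have za : z <= 1 + z ^+ alpha.
    have [z1|z1] := leP z 1; first by rewrite (le_trans z1)// lerDl exprn_ge0.
    apply: (@le_trans _ _ (z ^+ alpha)); last by rewrite lerDr.
    by rewrite -[leLHS]expr1 ler_eXn2l// ltW.
  apply: (le_trans za); rewrite lerD2l mulrC ler_pdivlMr// mulrC.
  by have := expR_ge1Dx (mu * z ^+ alpha); lra.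
rewrite ge0_integralD//; last 2 first.
  by move=> w _; rewrite mule_ge0 ?lee_fin ?expR_ge0.
  exact: measurable_funeM.
rewrite integral_cst// lte_add_pinfty//.
  by rewrite mul1e (le_lt_trans (probability_le1 P _))// ltry.
apply: (le_lt_trans XI); rewrite lte_mul_pinfty ?lee_fin ?mulr_ge0//.
by rewrite (le_lt_trans (probability_le1 P _))// ltry.
Qed.

(** Adding the constant [c] to [Z - F] yields a nonnegative process that dominates [Z] and starts
    below [1 + c]. As [F n.+1] is known at time [n], the term [c - F n.+1] can be put into the
    coefficient [A]. *)
Lemma stopped_expectation_le (Z F A B C : nat -> Omega -> R) (c : R) T :
  (forall n, measurable_fun setT (Z n)) -> (forall n w, 0 <= Z n w) ->
  {ae P, forall w, Z 0%N w <= 1} ->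
  measurable_fun setT (F 0%N) -> (forall n, sub_measurable (G n) (F n.+1)) ->
  (forall n w, 0 <= F n w <= c) ->
  (forall n, sub_measurable (G n) (A n)) ->
  (forall n, sub_measurable (G n) (B n)) ->
  (forall n, sub_measurable (G n) (C n)) ->
  (forall n w, 0 <= A n w) -> (forall n w, 0 <= C n w) ->
  (forall n, {ae P, forall w, Z n.+1 w <=
    A n w + B n w * zeta n.+1 w + C n w * X n.+1 w}) ->
  (forall n w, A n w + C n w * gamma <= Z n w + (F n.+1 w - F n w)) ->
  stopping_time G T ->
  (\int[P]_w (Z (T w) w)%:E <= (1 + c)%:E)%E.
Proof.
move=> mZ Z0 Z01 mF0 mF F01 mA mB mC A0 C0 Zle ACle hT.
have [sG Gm _] := hG.
have mF' n : measurable_fun setT (F n).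
  by case: n => // n; exact: sub_measurable_measurable (mF n).
pose U n w := Z n w + (c - F n w).
have mU n : measurable_fun setT (U n).
  by apply: measurable_funD => //; exact: measurable_funB.
have ZU n w : Z n w <= U n w.
  by rewrite lerDl subr_ge0; have /andP[] := F01 n w.
have U0 n w : 0 <= U n w := le_trans (Z0 n w) (ZU n w).
have Udecr n D : G n D ->
    (\int[P]_(w in D) (U n.+1 w)%:E <= \int[P]_(w in D) (U n w)%:E)%E.
  have [Y cY Yg] := hexp (ltn0Sn n); have [_ _ cz] := hzeta (ltn0Sn n).
  apply: (condexp_integral_le (sG n) (Gm n) cY (mX _) _ Yg gamma0 cz
    (A := fun w => A n w + (c - F n.+1 w)) (B := B n) (C := C n)) => //.
  - exact: (integrable_zeta (ltn0Sn n)).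
  - apply: measurable_funD; first exact: mA.
    by apply: measurable_funB => //; exact: mF.
  - by move=> w; rewrite addr_ge0// subr_ge0; have /andP[] := F01 n.+1 w.
  - by apply: filterS (Zle n) => w; rewrite /U /X /=; lra.
  - by move=> w; have := ACle n w; rewrite /U /=; lra.
apply: (@le_trans _ _ (\int[P]_w (U (T w) w)%:E)%E).
  apply: ge0_le_integral => //.
  - by move=> w _; rewrite lee_fin.
  - exact/measurable_EFinP/(measurable_stopped hG hT).
  - exact/measurable_EFinP/(measurable_stopped hG hT).
  - by move=> w _; rewrite lee_fin.
apply: (le_trans (stopped_integral_le hG mU U0 Udecr hT)).
apply: (@le_trans _ _ (\int[P]_w (1 + c)%:E)%E).
  apply: ae_ge0_le_integral => //.
  - by move=> w _; rewrite lee_fin.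
  - exact/measurable_EFinP.
  - move=> w _; rewrite lee_fin addr_ge0//.
    by have /andP[h1 h2] := F01 0%N w; apply: le_trans h1 h2.
  apply: filterS Z01 => w Z1 _; rewrite lee_fin /U.
  by have /andP[] := F01 0%N w; lra.
by rewrite integral_cst// [X in (_ * X)%E](@probability_setT _ _ _ P) mule1.
Qed.

End stopped_expectation.

(** * The deviation inequalities *)

Section measurability.
Context d (T : measurableType d) (R : realType).
Implicit Types (f p q : T -> R).

Lemma measurable_fun_inv_gt0 f : measurable_fun setT f -> (forall w, 0 < f w) ->
  measurable_fun setT (fun w => (f w)^-1).
Proof.
move=> mf f0; rewrite (_ : (fun w => _) = fun w => expR (- ln (f w))).
  by do 2 apply: measurableT_comp => //; exact: measurableT_comp.
by apply/funext => w; rewrite expRN lnK// posrE.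
Qed.

Lemma measurable_cosh f : measurable_fun setT f ->
  measurable_fun setT (fun w => cosh (f w)).
Proof.
move=> mf; apply: measurable_funM => //; apply: measurable_funD.
  exact: measurableT_comp.
by apply: measurableT_comp => //; exact: measurable_funN.
Qed.

Lemma measurable_gauss (mu gamma : R) p q :
  measurable_fun setT p -> measurable_fun setT q ->
  (forall w, p w < mu) ->
  measurable_fun setT (fun w => gauss_cst mu gamma (p w) (q w)) /\
  measurable_fun setT (fun w => gauss_slope mu gamma (p w) (q w)).
Proof.
move=> mp mq pmu.
have mt : measurable_fun setT (fun w => 2 * (p w + q w ^+ 2) / mu).
  apply: measurable_funM => //; apply: measurable_funM => //.
  by apply: measurable_funD => //; exact: measurable_funX.
have mt1 : measurable_fun setT (fun w => 2 * (p w + q w ^+ 2) / mu <= 1).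
  exact: measurable_fun_ler.
have mE f : measurable_fun setT f -> measurable_fun setT (fun w => expR (f w)).
  by move=> mf; exact: measurableT_comp.
split; apply: measurable_fun_ifT => //.
  apply: measurable_funM; first exact: measurable_funB.
  by apply: mE; exact: measurable_funM.
- apply: measurable_funM => //; apply: mE; apply: measurable_funM => //.
  exact: measurable_funB.
apply: mE; apply: measurable_funM; first exact: measurable_funX.
apply: measurable_fun_inv_gt0 => [|w]; last by rewrite mulr_gt0// subr_gt0.
by apply: measurable_funM => //; exact: measurable_funB.
Qed.

End measurability.

Section predictable_sum.
Context d (Omega : measurableType d) (R : realType).
Variables (G : nat -> set (set Omega)) (s : nat -> Omega -> R).
Hypotheses (hG : filtration G) (hs : adapted G s).

Lemma sub_measurableS (F F' : set (set Omega)) (X : Omega -> R) :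
  sigma_algebra setT F -> sigma_algebra setT F' -> F `<=` F' ->
  sub_measurable F X -> sub_measurable F' X.
Proof.
move=> sF sF' FF' mX _ B mB.
rewrite (@measurable_g_measurableTypeE Omega)//; apply: FF'.
by rewrite -(@measurable_g_measurableTypeE Omega F)//; exact: mX.
Qed.

Lemma predictable_sum0 w : predictable_sum s 0 w = 0.
Proof. by rewrite /predictable_sum big_geq. Qed.

Lemma predictable_sumS n w :
  predictable_sum s n.+1 w = predictable_sum s n w + s n w ^+ 2.
Proof. by rewrite /predictable_sum big_nat_recr. Qed.

Lemma predictable_sum_ge0 n w : 0 <= predictable_sum s n w.
Proof. by apply: sumr_ge0 => k _; rewrite sqr_ge0. Qed.

(** The shift of index matters: the sum at [n.+1] ends with [s n ^+ 2], so the next denominator is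
    already known at time [n] and may appear in [A], [B] and [C]. *)
Lemma sub_measurable_predictable_sum n :
  sub_measurable (G n) (predictable_sum s n.+1).
Proof.
have [sG _ Gmono] := hG.
elim: n => [|n IH].
  rewrite (_ : predictable_sum s 1 = fun w => s 0%N w ^+ 2).
    by apply: measurable_funX; exact: hs.
  by apply/funext => w; rewrite predictable_sumS predictable_sum0 add0r.
rewrite (_ : predictable_sum s n.+2 =
  fun w => predictable_sum s n.+1 w + s n.+1 w ^+ 2).
  apply: measurable_funD; last by apply: measurable_funX; exact: hs.
  exact: sub_measurableS (sG n) (sG n.+1) (Gmono _ _ (leqnSn n)) IH.
by apply/funext => w; rewrite predictable_sumS.
Qed.

Lemma sub_measurable_predictable_sum_pred n :
  sub_measurable (G n) (predictable_sum s n).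
Proof.
have [sG _ Gmono] := hG; case: n => [|n].
  rewrite (_ : predictable_sum s 0 = cst 0); first exact: measurable_cst.
  by apply/funext => w; rewrite predictable_sum0.
apply: sub_measurableS (sG n) (sG n.+1) (Gmono _ _ (leqnSn n)) _.
exact: sub_measurable_predictable_sum.
Qed.

End predictable_sum.

Lemma gain_ge0 (R : realType) (a w : R) : 0 < a <= w -> 0 <= gain a w <= 1.
Proof.
move=> /andP[a0 aw]; have w0 := lt_le_trans a0 aw.
by rewrite subr_ge0 ler_pdivrMr// mul1r aw/= gerBl divr_ge0// ltW.
Qed.

(** Origin of the range of [lambda]: for [lambda < mu], [2 lambda Gamma < 1] means
    [lambda (1 + 2 gamma) < mu - lambda], which is the assumed bound. *)
Lemma Gamma_const_bounds (R : realType) (mu gamma lambda : R) :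
  0 < mu -> 1 < gamma -> 0 <= lambda -> lambda < mu / (2 * (1 + gamma)) ->
  [/\ lambda < mu, 0 <= Gamma_const mu gamma lambda &
      2 * lambda * Gamma_const mu gamma lambda < 1].
Proof.
move=> mu0 g1 l0; rewrite ltr_pdivlMr; last lra.
move=> lmu; have lm : lambda < mu by nra.
have d : 0 < 2 * (mu - lambda) by lra.
split => //; first by rewrite divr_ge0 ?ltW//; lra.
by rewrite /Gamma_const mulrA ltr_pdivrMr//; lra.
Qed.

(** * Choice of [Z], [F], [A], [B], [C] in the two cases *)

Section deviation.
Context d (Omega : measurableType d) (R : realType) (P : probability Omega R).
Variables (G : nat -> set (set Omega)) (M s zeta : nat -> Omega -> R).
Variables (alpha : nat) (mu gamma : R).
Hypotheses (hG : filtration G) (hM : adapted G M).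
Hypothesis hM0 : {ae P, forall w, M 0%N w = 0}.
Hypotheses (hs : adapted G s) (hzeta : martingale_increments P G zeta).
Hypothesis hMsz : forall n, (1 <= n)%N ->
  {ae P, forall w, M n w - M n.-1 w = s n.-1 w * zeta n w}.
Hypotheses (hmu : 0 < mu) (hgamma : 1 < gamma).
Hypothesis hexp : forall k, (1 <= k)%N ->
  exists2 Y, is_condexp P (G k.-1)
               (fun w => (expR (mu * `|zeta k w| ^+ alpha))%:E) Y
           & {ae P, forall w, (Y w <= gamma%:E)%E}.
Variables (a : R) (a0 : 0 < a) (T : Omega -> nat) (hT : stopping_time G T).

Let W n w := a + predictable_sum s n w.

Let gamma0 : 0 <= gamma. Proof. by rewrite ltW// (lt_trans ltr01). Qed.

Let W_ge n w : a <= W n w. Proof. by rewrite lerDl predictable_sum_ge0. Qed.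

Let W_gt0 n w : 0 < W n w. Proof. exact: lt_le_trans (W_ge n w). Qed.

Let WS n w : W n.+1 w = W n w + s n w ^+ 2.
Proof. by rewrite /W predictable_sumS addrA. Qed.

Let mW n : sub_measurable (G n) (W n).
Proof.
apply: measurable_funD => //.
exact: (sub_measurable_predictable_sum_pred hG hs).
Qed.

Let mW1 n : sub_measurable (G n) (W n.+1).
Proof.
by apply: measurable_funD => //; exact: (sub_measurable_predictable_sum hG hs).
Qed.

Let to_measurable n (X : Omega -> R) :
  sub_measurable (G n) X -> measurable_fun setT X.
Proof. by have [sG Gm _] := hG; exact: sub_measurable_measurable. Qed.

Let M_next n : {ae P, forall w, M n.+1 w = M n w + s n w * zeta n.+1 w}.
Proof. by apply: filterS (hMsz (ltn0Sn n)) => w /= <-; rewrite addrC subrK. Qed.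

Let gain01 n w : 0 <= gain a (W n w) <= 1.
Proof. by apply: gain_ge0; rewrite a0 W_ge. Qed.

Lemma gaussian_deviation (lambda : R) : alpha = 2%N ->
  0 <= lambda -> lambda < mu / (2 * (1 + gamma)) ->
  (\int[P]_w (expR (lambda * (a * M (T w) w ^+ 2 / W (T w) w ^+ 2)))%:E
    <= (1 + c_const mu gamma lambda)%:E)%E.
Proof.
move=> alpha2 l0 lmu2.
have [lmu G0 lG] := Gamma_const_bounds hmu hgamma l0 lmu2.
set g := Gamma_const mu gamma lambda in G0 lG.
set K := expR (lambda * g / (2 * (1 - 2 * lambda * g))).
pose Z n w := expR (lambda * (a * M n w ^+ 2 / W n w ^+ 2)).
pose F n w := K * (expR (lambda * g * gain a (W n w)) - 1).
(* [p] and [q] come from expanding the square of [M n.+1 = M n + s n * zeta n.+1] in the exponent of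
   [Z n.+1]; [E] is the part free of [zeta], with the old [M] over the new denominator. *)
pose p n w := lambda * a * s n w ^+ 2 / W n.+1 w ^+ 2.
pose q n w := 2 * lambda * a * M n w * s n w / W n.+1 w ^+ 2.
pose E n w := expR (lambda * (a * M n w ^+ 2 / W n.+1 w ^+ 2)).
pose A n w := E n w * gauss_cst mu gamma (p n w) (q n w).
pose C n w := E n w * gauss_slope mu gamma (p n w) (q n w).
have p0 n w : 0 <= p n w <= lambda.
  have s0 := sqr_ge0 (s n w); have w0 := W_ge n w; have a0' := ltW a0.
  apply/andP; split.
    by apply: divr_ge0; [apply: mulr_ge0 => //; exact: mulr_ge0|exact: sqr_ge0].
  (* [a] and [s n ^+ 2] are each at most [W n.+1], so [p <= lambda]. *)
  rewrite ler_pdivrMr ?exprn_gt0// -mulrA ler_wpM2l// WS expr2.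
  by apply: ler_pM => //; lra.
have pmu n w : p n w < mu by have /andP[_ h] := p0 n w; exact: le_lt_trans h lmu.
have mquot n m (f : Omega -> R) : sub_measurable (G n) f ->
    sub_measurable (G n) (W m) ->
    sub_measurable (G n) (fun w => f w / W m w ^+ 2).
  move=> mf mw; apply: measurable_funM => //.
  apply: measurable_fun_inv_gt0 => [|w]; last by rewrite exprn_gt0.
  exact: measurable_funX.
have mEZ n m : sub_measurable (G n) (W m) ->
    sub_measurable (G n)
      (fun w => expR (lambda * (a * M n w ^+ 2 / W m w ^+ 2))).
  move=> mw; apply: measurableT_comp => //; apply: measurable_funM => //.
  apply: mquot => //; apply: measurable_funM => //.
  by apply: measurable_funX; exact: hM.
have mp n : sub_measurable (G n) (p n).
  apply: mquot => //; apply: measurable_funM => //.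
  by apply: measurable_funX; exact: hs.
have mq n : sub_measurable (G n) (q n).
  apply: mquot => //; apply: measurable_funM; last exact: hs.
  by apply: measurable_funM => //; exact: hM.
have mgauss n := measurable_gauss gamma (mp n) (mq n) (pmu n).
have mF n m : sub_measurable (G n) (W m) -> sub_measurable (G n) (F m).
  move=> mw; apply: measurable_funM => //; apply: measurable_funB => //.
  apply: measurableT_comp => //; apply: measurable_funM => //.
  apply: measurable_funB => //; apply: measurable_funM => //.
  exact: measurable_fun_inv_gt0.
have -> : c_const mu gamma lambda = K * (expR (lambda * g) - 1) by [].
have K0 : 0 <= K by exact: expR_ge0.
have lg0 : 0 <= lambda * g by rewrite mulr_ge0.
apply: (@stopped_expectation_le _ _ _ P G zeta alpha mu gamma hG hzeta _ hmu
  gamma0 hexp Z F A (fun n w => E n w * q n w) C) => //.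
- by rewrite alpha2.
- by move=> n; apply: to_measurable; exact: mEZ.
- by move=> n w; exact: expR_ge0.
- apply: filterS hM0 => w /= Mw.
  by rewrite /Z Mw expr0n/= mulr0 mul0r mulr0 expR0.
- by apply: (@to_measurable 0%N); exact: mF.
- by move=> n; exact: mF.
- move=> n w; have /andP[h1 h2] := gain01 n w; rewrite /F; apply/andP; split.
    by rewrite mulr_ge0// subr_ge0 -[leLHS]expR0 ler_expR mulr_ge0.
  by rewrite ler_wpM2l// lerB// ler_expR ler_piMr.
- by move=> n; apply: measurable_funM; [exact: mEZ|exact: (mgauss n).1].
- by move=> n; apply: measurable_funM; [exact: mEZ|exact: mq].
- by move=> n; apply: measurable_funM; [exact: mEZ|exact: (mgauss n).2].
- by move=> n w; rewrite mulr_ge0 ?expR_ge0 ?gauss_cst_ge0.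
- move=> n w; rewrite mulr_ge0 ?expR_ge0 ?gauss_slope_ge0//.
  by have /andP[] := p0 n w.
- move=> n; apply: filterS (M_next n) => w Mw.
  have /andP[p00 _] := p0 n w.
  have gp : 0 <= p n w < mu by rewrite p00 pmu.
  have := ler_wpM2l (expR_ge0 (lambda * (a * M n w ^+ 2 / W n.+1 w ^+ 2)))
    (expR_gauss_le (q n w) (zeta n.+1 w) hmu (lt_trans ltr01 hgamma) gp).
  rewrite alpha2 real_normK ?num_real// -expRD.
  have -> : lambda * (a * M n w ^+ 2 / W n.+1 w ^+ 2) +
      (p n w * zeta n.+1 w ^+ 2 + q n w * zeta n.+1 w) =
    lambda * (a * M n.+1 w ^+ 2 / W n.+1 w ^+ 2).
    by rewrite Mw /p /q; field; rewrite gt_eqF.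
  by rewrite -/(E n w) /A /C /Z; lra.
- move=> n w; have aw : 0 < a <= W n w by rewrite a0 W_ge.
  have h1 := ler_wpM2l (expR_ge0 (lambda * (a * M n w ^+ 2 / W n.+1 w ^+ 2)))
    (gauss_mean_le (q n w) hgamma lmu hmu (p0 n w)).
  have h2 := gauss_drift_le (M n w) (s n w) l0 G0 lG aw.
  rewrite -WS -/(p n w) -/(q n w) in h2.
  have := le_trans h1 h2.
  by rewrite -/(E n w) /A /C /Z /F -/g -/K; lra.
Qed.

Lemma exponential_deviation (lambda : R) : alpha = 1%N ->
  - mu < lambda -> lambda < mu ->
  (\int[P]_w (cosh (lambda * (Num.sqrt a * M (T w) w / W (T w) w)))%:E
    <= (1 + c'_const mu gamma lambda)%:E)%E.
Proof.
move=> alpha1 lmuN lmu; set K := c'_const mu gamma lambda.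
pose k := (gamma - 1) * lambda ^+ 2 / mu ^+ 2.
(* Separate indices for [M] and [W]: [x n n.+1] is the argument after contraction but before the
   increment. *)
pose x n m w := lambda * (Num.sqrt a * M n w / W m w).
(* Chosen so that the increment of the argument of [cosh] has absolute value [eta * (mu * |zeta|)],
   matching the exponential moment. *)
pose eta n w := `|lambda| / mu * (Num.sqrt a * `|s n w| / W n.+1 w).
pose Z n w := cosh (x n n w).
pose F n w := K * gain a (W n w).
pose A n w := cosh (x n n.+1 w) * (1 - eta n w ^+ 2).
pose B n w := (expR (x n n.+1 w) - expR (- x n n.+1 w)) / 2 *
  (lambda * (Num.sqrt a * s n w / W n.+1 w)).
pose C n w := cosh (x n n.+1 w) * eta n w ^+ 2.
have k0 : 0 <= k.
  by rewrite divr_ge0 ?sqr_ge0// mulr_ge0 ?sqr_ge0// subr_ge0 ltW.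
have ch0 (y : R) : 0 <= cosh y := le_trans ler01 (cosh_ge1 y).
have K0 : 0 <= K.
  by rewrite /K /c'_const -/k mulr_ge0 ?ch0// mulr_ge0// expR_ge0.
have sa : Num.sqrt a ^+ 2 = a by rewrite sqr_sqrtr// ltW.
pose t n w := s n w ^+ 2 / W n.+1 w.
have t01 n w : 0 <= t n w <= 1.
  apply/andP; split; first by rewrite divr_ge0 ?sqr_ge0// ltW.
  by rewrite ler_pdivrMr// mul1r WS lerDr ltW.
have b01 n w : 0 <= a / W n w <= 1.
  apply/andP; split; first by rewrite divr_ge0// ltW.
  by rewrite ler_pdivrMr// mul1r.
have tE n w : 1 - t n w = W n w / W n.+1 w.
  have := W_gt0 n.+1 w; rewrite /t WS => w0.
  by field; rewrite gt_eqF.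
have etaE n w : eta n w ^+ 2 =
    lambda ^+ 2 / mu ^+ 2 * (a / W n w * (1 - t n w) * t n w).
  rewrite tE /eta /t !exprMn !exprVn sa !real_normK ?num_real//.
  by field; rewrite !gt_eqF.
have lmu1 : lambda ^+ 2 / mu ^+ 2 <= 1.
  by rewrite ler_pdivrMr ?exprn_gt0// mul1r; nra.
have eta0 n w : 0 <= eta n w.
  by rewrite mulr_ge0// divr_ge0 ?mulr_ge0 ?sqrtr_ge0// ltW.
have btt n w : 0 <= a / W n w * (1 - t n w) * t n w <= 1.
  have /andP[t0 t1] := t01 n w; have /andP[b0 b1] := b01 n w.
  have u0 : 0 <= 1 - t n w by rewrite subr_ge0.
  have bu0 : 0 <= a / W n w * (1 - t n w) by rewrite mulr_ge0.
  by rewrite mulr_ge0//= mulr_ile1// mulr_ile1//; lra.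
(* Here [|lambda| < mu] enters. The bound is what [coshD_le] requires, and it makes [A]
   nonnegative. *)
have eta1 n w : 0 <= eta n w <= 1.
  rewrite eta0/= -(@expr_le1 _ 2)// etaE.
  have /andP[h1 h2] := btt n w.
  by rewrite mulr_ile1// divr_ge0 ?sqr_ge0.
have mquot n m (f : Omega -> R) : sub_measurable (G n) f ->
    sub_measurable (G n) (W m) -> sub_measurable (G n) (fun w => f w / W m w).
  by move=> mf mw; apply: measurable_funM => //; exact: measurable_fun_inv_gt0.
have mx n m : sub_measurable (G n) (W m) -> sub_measurable (G n) (x n m).
  move=> mw; apply: measurable_funM => //; apply: mquot => //.
  by apply: measurable_funM => //; exact: hM.
have meta n : sub_measurable (G n) (eta n).
  apply: measurable_funM => //; apply: mquot => //; apply: measurable_funM => //.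
  by apply: measurableT_comp => //; exact: hs.
have mch n m : sub_measurable (G n) (W m) ->
    sub_measurable (G n) (fun w => cosh (x n m w)).
  by move=> mw; apply: measurable_cosh; exact: mx.
have mF n m : sub_measurable (G n) (W m) -> sub_measurable (G n) (F m).
  move=> mw; apply: measurable_funM => //.
  apply: measurable_funB => //; apply: measurable_funM => //.
  exact: measurable_fun_inv_gt0.
apply: (@stopped_expectation_le _ _ _ P G zeta alpha mu gamma hG hzeta _ hmu
  gamma0 hexp Z F A B C) => //.
- by rewrite alpha1.
- by move=> n; apply: to_measurable; exact: mch.
- by move=> n w; exact: ch0.
- apply: filterS hM0 => w /= Mw.
  by rewrite /Z /x Mw mulr0 mul0r mulr0 /cosh oppr0 expR0; lra.
- by apply: (@to_measurable 0%N); exact: mF.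
- by move=> n; exact: mF.
- move=> n w; have /andP[h1 h2] := gain01 n w; rewrite /F.
  by rewrite mulr_ge0//= ler_piMr.
- move=> n; apply: measurable_funM; first exact: mch.
  by apply: measurable_funB => //; apply: measurable_funX; exact: meta.
- move=> n; apply: measurable_funM.
    apply: measurable_funM => //; apply: measurable_funB.
      by apply: measurableT_comp => //; exact: mx.
    by apply: measurableT_comp => //; apply: measurable_funN; exact: mx.
  apply: measurable_funM => //; apply: mquot => //.
  by apply: measurable_funM => //; exact: hs.
- move=> n; apply: measurable_funM; first exact: mch.
  by apply: measurable_funX; exact: meta.
- move=> n w; rewrite mulr_ge0// subr_ge0.
  by have /andP[h1 h2] := eta1 n w; rewrite expr_le1.
- by move=> n w; rewrite mulr_ge0// sqr_ge0.
- move=> n; apply: filterS (M_next n) => w Mw.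
  have zm : 0 <= mu * `|zeta n.+1 w| by rewrite mulr_ge0// ltW.
  pose y := lambda * (Num.sqrt a * s n w / W n.+1 w) * zeta n.+1 w.
  have ye : `|y| = eta n w * (mu * `|zeta n.+1 w|).
    rewrite /y /eta !normrM (ger0_norm (sqrtr_ge0 a)) normrV ?unitfE ?gt_eqF//.
    by rewrite (gtr0_norm (W_gt0 n.+1 w)); field; rewrite !gt_eqF.
  have := coshD_le (x n n.+1 w) (eta1 n w) zm ye.
  rewrite alpha1 expr1.
  have -> : x n n.+1 w + y = x n.+1 n.+1 w.
    by rewrite /x /y Mw; ring.
  by rewrite /A /B /C /Z /y; lra.
- move=> n w; rewrite /A /C /F /Z.
  (* The mean brings the factor [1 + (gamma - 1) eta^2], whence [k = (gamma - 1) lambda^2 / mu^2] in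
     [c'_const]. *)
  have -> : cosh (x n n.+1 w) * (1 - eta n w ^+ 2) +
      cosh (x n n.+1 w) * eta n w ^+ 2 * gamma =
    cosh (x n n w * (1 - t n w)) *
      (1 + k * (a / W n w * (1 - t n w) * t n w)).
    have -> : x n n w * (1 - t n w) = x n n.+1 w.
      by rewrite tE /x; field; rewrite !gt_eqF.
    by rewrite etaE /k; ring.
  have := cosh_drift_le (x n n w) k0 (b01 n w) (t01 n w).
  rewrite -/(c'_const mu gamma lambda) -/K.
  have -> : gain a (W n.+1 w) = gain a (W n w) + a / W n w * t n w.
    have w0 := W_gt0 n.+1 w; rewrite WS in w0.
    by rewrite /gain /t WS; field; rewrite !gt_eqF.
  by move=> h; apply: (le_trans h); rewrite /K /c'_const -/k; lra.
Qed.

End deviation.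

Theorem theorem2 (d : measure_display) (Omega : measurableType d)
    (R : realType) (P : probability Omega R)
    (G : nat -> set (set Omega)) (M s zeta : nat -> Omega -> R)
    (alpha : nat) (mu gamma : R)
    (hG : filtration G)
    (hM : local_martingale P G M)
    (hM0 : {ae P, forall w, M 0%N w = 0})
    (hs : adapted G s)
    (hzeta : martingale_increments P G zeta)
    (hMsz : forall n, (1 <= n)%N ->
      {ae P, forall w, M n w - M n.-1 w = s n.-1 w * zeta n w})
    (halpha : alpha = 1%N \/ alpha = 2%N)
    (hmu : 0 < mu) (hgamma : 1 < gamma)
    (hexp : forall k, (1 <= k)%N ->
      exists2 Y, is_condexp P (G k.-1)
                   (fun w => (expR (mu * `|zeta k w| ^+ alpha))%:E) Y
               & {ae P, forall w, (Y w <= gamma%:E)%E}) :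
  let V := predictable_sum s in
  (alpha = 2%N ->
    forall lambda : R, 0 <= lambda -> lambda < mu / (2 * (1 + gamma)) ->
    forall a : R, 0 < a ->
    forall T : Omega -> nat, stopping_time G T ->
    ('E_P[fun w => expR (lambda *
             (a * M (T w) w ^+ 2 / (a + V (T w) w) ^+ 2))]
      <= (1 + c_const mu gamma lambda)%:E)%E) /\
  (alpha = 1%N ->
    forall lambda : R, - mu < lambda -> lambda < mu ->
    forall a : R, 0 < a ->
    forall T : Omega -> nat, stopping_time G T ->
    ('E_P[fun w => cosh (lambda *
             (Num.sqrt a * M (T w) w / (a + V (T w) w)))]
      <= (1 + c'_const mu gamma lambda)%:E)%E).

Proof.
move=> V; split=> halpha' lambda l1 l2 a a0 T hT; rewrite unlock.
- exact: (gaussian_deviation hG hM.1 hM0 hs hzeta hMsz hmu hgamma hexp a0 hT).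
- exact: (exponential_deviation hG hM.1 hM0 hs hzeta hMsz hmu hgamma hexp a0 hT).
Qed.
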